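(* (i) In every weakly orthomodular lattice, $(a\equiv b)\to_0((a\equiv c)\equiv(b\equiv c)) = 1$ for all elements $a,b,c$. (ii) There exists a weakly orthomodular lattice containing elements $a,b,c$ with $(a\equiv b)\cap((b\equiv c)\cup(a\equiv c)) \ne ((a\equiv b)\cap(b\equiv c))\cup((a\equiv b)\cap(a\equiv c))$.
   Context: A weakly orthomodular lattice (WOML) is an ortholattice $(L,\cap,\cup,{}',0,1)$ satisfying $(a'\cap(a\cup b))\cup b'\cup(a\cap b)=1$ for all $a,b$. Notation: $a\equiv b=(a\cap b)\cup(a'\cap b')$ and $a\to_0 b=a'\cup b$. *)

(* Defs.v *)
Record ortholattice := OL {
  carrier :> Type;
  meet : carrier -> carrier -> carrier;
  join : carrier -> carrier -> carrier;
  compl : carrier -> carrier;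
  zero : carrier;
  one : carrier;
  meetC : forall a b, meet a b = meet b a;
  joinC : forall a b, join a b = join b a;
  meetA : forall a b c, meet a (meet b c) = meet (meet a b) c;
  joinA : forall a b c, join a (join b c) = join (join a b) c;
  meet_absorb : forall a b, meet a (join a b) = a;
  join_absorb : forall a b, join a (meet a b) = a;
  join0 : forall a, join a zero = a;
  meet1 : forall a, meet a one = a;
  complK : forall a, compl (compl a) = a;
  compl_antitone : forall a b, meet a b = a -> meet (compl b) (compl a) = compl b;
  meet_compl : forall a, meet a (compl a) = zero;
  join_compl : forall a, join a (compl a) = one
}.

Arguments meet {o}.
Arguments join {o}.
Arguments compl {o}.
Arguments zero {o}.
Arguments one {o}.

Definition is_WOML (L : ortholattice) : Prop :=
  forall a b : L,
    join (join (meet (compl a) (join a b)) (compl b)) (meet a b) = one.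

Definition equiv {L : ortholattice} (a b : L) : L :=
  join (meet a b) (meet (compl a) (compl b)).

Definition imp0 {L : ortholattice} (a b : L) : L := join (compl a) b.

(* Main.v *)
(** Call [a] weakly below [b] when [a] meets the complement of [a ∩ b] in [0]. In a weakly
    orthomodular lattice this is a preorder, compatible with [∩] and antitone for the
    complement, and only [0] is weakly below [0]; so an inequality valid in all orthomodular
    lattices survives in its weak form.

    For (i), put [p = a ∩ b], [q = a' ∩ b'], [s = (a ∩ c) ∪ (b ∩ c)] and
    [t = (a' ∩ c') ∪ (b' ∩ c')]. Each of [p], [s] is orthogonal to each of [q], [t], so
    [m = p ∪ s] separates the two pairs and [(p ∪ q) ∩ (s ∪ t)] is weakly below
    [(p ∩ s) ∪ (q ∩ t)]. The former is above [(a ≡ b) ∩ ((a ≡ c) ∪ (b ≡ c))], the latter is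
    below [(a ≡ c) ∩ (b ≡ c)].

    The same computation shows that the equation in (ii) does hold in every orthomodular
    lattice, so the counterexample must be a non-orthomodular lattice; the one used here is
    the Boolean algebra with three atoms in which every element other than [0] and [1] is
    split into two comparable ones. *)

From Stdlib Require Import Setoid.
Require Import Defs.

(** * Order and De Morgan laws in an ortholattice *)

Section Ortholattice.

Variable L : ortholattice.
Implicit Types a b c x y : L.

Definition le a b : Prop := meet a b = a.

Lemma meet_idem a : meet a a = a.
Proof. rewrite <- (join0 L a) at 2. apply meet_absorb. Qed.

Lemma le_refl a : le a a.
Proof. apply meet_idem. Qed.

Lemma le_trans b a c : le a b -> le b c -> le a c.
Proof. unfold le. intros Hab Hbc. rewrite <- Hab at 1. now rewrite <- meetA, Hbc. Qed.

Lemma le_antisym a b : le a b -> le b a -> a = b.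
Proof. unfold le. intros Hab Hba. rewrite <- Hab, meetC. exact Hba. Qed.

Lemma meet_lel a b c : le a c -> le (meet a b) c.
Proof.
  intros H. apply (le_trans a); trivial.
  unfold le. now rewrite (meetC L (meet a b)), meetA, meet_idem.
Qed.

Lemma meet_ler a b c : le b c -> le (meet a b) c.
Proof. rewrite meetC. apply meet_lel. Qed.

Lemma le_meet a b c : le c a -> le c b -> le c (meet a b).
Proof. unfold le. intros Ha Hb. now rewrite meetA, Ha. Qed.

Lemma le_joinl a b c : le c a -> le c (join a b).
Proof. intros H. apply (le_trans a); trivial. apply meet_absorb. Qed.

Lemma le_joinr a b c : le c b -> le c (join a b).
Proof. rewrite joinC. apply le_joinl. Qed.

Lemma join_of_le a b : le a b -> join a b = b.
Proof. unfold le. intros H. now rewrite <- H, meetC, joinC, join_absorb. Qed.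

Lemma join_le a b c : le a c -> le b c -> le (join a b) c.
Proof.
  intros Ha%join_of_le Hb%join_of_le. unfold le.
  rewrite <- Hb, <- Ha, (joinA L b), (joinC L b a). apply meet_absorb.
Qed.

Lemma le_compl a b : le a b -> le (compl b) (compl a).
Proof. apply compl_antitone. Qed.

Lemma le_compl_sym a b : le a (compl b) -> le b (compl a).
Proof. intros H%le_compl. now rewrite complK in H. Qed.

Lemma compl_join a b : compl (join a b) = meet (compl a) (compl b).
Proof.
  apply le_antisym.
  - apply le_meet; apply le_compl; [apply le_joinl | apply le_joinr]; apply le_refl.
  - apply le_compl_sym. apply join_le; apply le_compl_sym;
      [apply meet_lel | apply meet_ler]; apply le_refl.
Qed.

Lemma compl_meet a b : compl (meet a b) = join (compl a) (compl b).
Proof.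
  rewrite <- (complK L a), <- (complK L b) at 1. now rewrite <- compl_join, complK.
Qed.

Lemma zero_le a : le zero a.
Proof. rewrite <- (meet_compl L a). apply meet_lel, le_refl. Qed.

Lemma le_zero a : le a zero -> a = zero.
Proof. intros H. apply le_antisym; trivial. apply zero_le. Qed.

Lemma compl_one : compl one = zero :> L.
Proof. rewrite <- (meet1 L (compl one)), meetC. apply meet_compl. Qed.

Lemma compl_zero : compl zero = one :> L.
Proof. rewrite <- compl_one. apply complK. Qed.

Lemma zero_join a : join zero a = a.
Proof. rewrite joinC. apply join0. Qed.

Lemma le_disjoint b a : le a b -> le a (compl b) -> a = zero.
Proof.
  intros H1 H2. apply le_zero. rewrite <- (meet_compl L b). now apply le_meet.
Qed.

(** * The weak order *)

Definition wle a b : Prop := meet a (compl (meet a b)) = zero.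

Lemma le_wle a b : le a b -> wle a b.
Proof. unfold le, wle. intros ->. apply meet_compl. Qed.

(** Here [a ∩ b = b]. Without [le b a], the condition [a ∩ b' = 0] is too weak for an order: it is
    not transitive even in orthomodular lattices. *)
Lemma wle_of_skew a b : meet a (compl b) = zero -> le b a -> wle a b.
Proof. unfold wle. intros H Hba. red in Hba. now rewrite (meetC L a b), Hba. Qed.

Lemma wle_skew a b : wle a b -> meet a (compl b) = zero.
Proof.
  intros H. apply le_zero. rewrite <- H.
  apply le_meet; [apply meet_lel, le_refl | apply meet_ler, le_compl, meet_ler, le_refl].
Qed.

Hypothesis woml : is_WOML L.

(** The assumptions erase two of the three joinands in the law for [a], [w], leaving [w' = 1]. *)
Lemma zero_of_separated a w :
  meet a w = zero -> meet (compl a) (join a w) = zero -> w = zero.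
Proof.
  intros H1 H2. pose proof (woml a w) as H.
  rewrite H1, H2, join0, zero_join in H.
  now rewrite <- (complK L w), H, compl_one.
Qed.

(** A weak substitute for orthomodularity: [x' ∩ (x ∪ w)] lies below [y ∩ x' = 0], so [x] and [w]
    are separated. *)
Lemma zero_of_skew x y w :
  le x y -> meet y (compl x) = zero -> le w y -> meet x w = zero -> w = zero.
Proof.
  intros Hxy Hyx Hwy Hxw. apply (zero_of_separated x); trivial.
  apply le_zero. rewrite <- Hyx. apply le_meet.
  - apply meet_ler, join_le; trivial.
  - apply meet_lel, le_refl.
Qed.

(** In the law for [a'], [b'] the first term is [a ∩ (a ∩ b)' = 0]; complementing the remaining
    [b ∪ (a' ∩ b') = 1] gives the claim. *)
Lemma wle_compl a b : wle a b -> wle (compl b) (compl a).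
Proof.
  intros H. red. pose proof (woml (compl a) (compl b)) as W.
  red in H. rewrite compl_meet in H.
  rewrite !complK, H, zero_join in W.
  rewrite <- (complK L b) in W at 1.
  rewrite <- (complK L (meet (compl a) (compl b))), <- compl_meet in W.
  rewrite (meetC L (compl b) (compl a)).
  apply (f_equal compl) in W. now rewrite complK, compl_one in W.
Qed.

Lemma wle_meetr a b c : wle a b -> wle (meet a c) (meet (meet a b) c).
Proof.
  intros H. apply wle_of_skew.
  - apply (zero_of_skew (meet a b) a).
    + apply meet_lel, le_refl.
    + exact H.
    + apply meet_lel, meet_lel, le_refl.
    + apply (le_disjoint (meet (meet a b) c)).
      * apply le_meet; [apply meet_lel, le_refl |].
        apply meet_ler, meet_lel, meet_ler, le_refl.
      * apply meet_ler, meet_ler, le_refl.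
  - apply le_meet; [apply meet_lel, meet_lel, le_refl | apply meet_ler, le_refl].
Qed.

Lemma wle_trans b a c : wle a b -> wle b c -> wle a c.
Proof.
  intros Hab Hbc.
  set (d := meet (meet b c) a).
  assert (Hd : le d (meet a c)).
  { apply le_meet; [apply meet_ler, le_refl | apply meet_lel, meet_ler, le_refl]. }
  red. apply (zero_of_skew (meet a b) a).
  - apply meet_lel, le_refl.
  - exact Hab.
  - apply meet_lel, le_refl.
  (* Inside [a ∩ b], the excess of [a] over [a ∩ c] avoids [d], but [b ∩ a] is weakly below [d]. *)
  - apply le_zero. rewrite <- (wle_skew _ _ (wle_meetr b c a Hbc)). fold d.
    rewrite (meetC L b a). apply le_meet.
    + apply meet_lel, le_refl.
    + apply meet_ler, meet_ler, le_compl, Hd.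
Qed.

Lemma wle_meet a b c : wle c a -> wle c b -> wle c (meet a b).
Proof.
  intros Ha Hb. apply (wle_trans (meet c a)).
  - red. now rewrite meetA, meet_idem.
  - apply (wle_trans (meet (meet c b) a)).
    + apply wle_meetr, Hb.
    + apply le_wle, le_meet;
        [apply meet_ler, le_refl | apply meet_lel, meet_ler, le_refl].
Qed.

Lemma wle_zero a : wle a zero -> a = zero.
Proof. intros H%wle_skew. now rewrite compl_zero, meet1 in H. Qed.

(** * Meets of orthogonal joins, and part (i) *)

Lemma wle_meet_join p q m : le p m -> le m (compl q) -> wle (meet m (join p q)) p.
Proof.
  intros Hp Hq. apply wle_of_skew.
  - apply (le_disjoint (join p q)).
    + apply meet_lel, meet_ler, le_refl.
    + rewrite compl_join. apply le_meet;
        [apply meet_ler, le_refl | apply meet_lel, meet_lel, Hq].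
  - apply le_meet; [trivial | apply le_joinl, le_refl].
Qed.

Lemma wle_orthogonal_joins p q s t :
  le p (compl q) -> le p (compl t) -> le s (compl q) -> le s (compl t) ->
  wle (meet (join p q) (join s t)) (join (meet p s) (meet q t)).
Proof.
  intros Hpq Hpt Hsq Hst.
  set (v := join (meet p s) (meet q t)). set (m := join p s).
  assert (Hpm : le p m) by apply le_joinl, le_refl.
  assert (Hsm : le s m) by apply le_joinr, le_refl.
  assert (Hmq : le m (compl q)) by now apply join_le.
  assert (Hmt : le m (compl t)) by now apply join_le.
  assert (Hqm : le q (compl m)) by now apply le_compl_sym.
  assert (Htm : le t (compl m)) by now apply le_compl_sym.
  assert (Hm : le (compl m) (compl m)) by apply le_refl.
  (* [k] is the excess over [v], to be shown zero by testing it against [m] and [m']. *)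
  red. set (k := meet _ (compl _)).
  assert (Hkpq : le k (join p q)) by apply meet_lel, meet_lel, le_refl.
  assert (Hkst : le k (join s t)) by apply meet_lel, meet_ler, le_refl.
  assert (Hvk : le v (compl k)).
  { apply le_compl_sym, meet_ler, le_compl, le_meet; [| apply le_refl].
    apply join_le; apply le_meet.
    - apply meet_lel, le_joinl, le_refl.
    - apply meet_ler, le_joinl, le_refl.
    - apply meet_lel, le_joinr, le_refl.
    - apply meet_ler, le_joinr, le_refl. }
  assert (Hmk : wle (meet m k) v).
  { apply (wle_trans (meet p s)); [| apply le_wle, le_joinl, le_refl].
    apply wle_meet.
    - apply (wle_trans (meet m (join p q))); [| now apply wle_meet_join].
      apply le_wle, le_meet; [apply meet_lel, le_refl | now apply meet_ler].
    - apply (wle_trans (meet m (join s t))); [| now apply wle_meet_join].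
      apply le_wle, le_meet; [apply meet_lel, le_refl | now apply meet_ler]. }
  (* The Sasaki projection of [k] to [m']: it stands in for [m' ∩ k], since the law for [m], [k]
     speaks of it. *)
  set (e := meet (compl m) (join m k)).
  assert (He : wle e v).
  { apply (wle_trans (meet q t)); [| apply le_wle, le_joinr, le_refl].
    apply wle_meet.
    - apply (wle_trans (meet (compl m) (join q m))); [| now apply wle_meet_join].
      apply le_wle, le_meet; [apply meet_lel, le_refl |].
      apply meet_ler, join_le; [apply le_joinr, le_refl |].
      apply (le_trans (join p q)); trivial.
      apply join_le; [now apply le_joinr | apply le_joinl, le_refl].
    - apply (wle_trans (meet (compl m) (join t m))); [| now apply wle_meet_join].
      apply le_wle, le_meet; [apply meet_lel, le_refl |].
      apply meet_ler, join_le; [apply le_joinr, le_refl |].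
      apply (le_trans (join s t)); trivial.
      apply join_le; [now apply le_joinr | apply le_joinl, le_refl]. }
  assert (Hmk0 : meet m k = zero).
  { apply wle_zero. rewrite <- (meet_compl L k). apply wle_meet.
    - apply le_wle, meet_ler, le_refl.
    - apply (wle_trans v); [exact Hmk | apply le_wle, Hvk]. }
  pose proof (woml m k) as W. fold e in W. rewrite Hmk0, join0 in W.
  assert (Hke : meet k (compl e) = zero).
  { now rewrite <- compl_one, <- W, compl_join, complK, meetC. }
  (* As [e] is weakly below [v], hence below [k'], contraposition puts [k] weakly below [e'], which
     it meets in [0]. *)
  apply wle_zero. rewrite <- Hke. apply wle_meet; [apply le_wle, le_refl |].
  rewrite <- (complK L k). apply wle_compl.
  apply (wle_trans v); [exact He | apply le_wle, Hvk].
Qed.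

Lemma meet_equiv_wle a b c :
  wle (meet (equiv a b) (join (equiv a c) (equiv b c))) (meet (equiv a c) (equiv b c)).
Proof.
  set (p := meet a b). set (q := meet (compl a) (compl b)).
  set (s := join (meet a c) (meet b c)).
  set (t := join (meet (compl a) (compl c)) (meet (compl b) (compl c))).
  assert (Hq : compl q = join a b) by (unfold q; now rewrite <- compl_join, complK).
  assert (Hp : compl p = join (compl a) (compl b)) by apply compl_meet.
  apply (wle_trans (meet (join p q) (join s t))).
  { apply le_wle, le_meet; [apply meet_lel, le_refl | apply meet_ler].
    apply join_le; apply join_le.
    - apply le_joinl, le_joinl, le_refl.
    - apply le_joinr, le_joinl, le_refl.
    - apply le_joinl, le_joinr, le_refl.
    - apply le_joinr, le_joinr, le_refl. }
  apply (wle_trans (join (meet p s) (meet q t))).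
  - apply wle_orthogonal_joins.
    + rewrite Hq. apply meet_lel, le_joinl, le_refl.
    + apply le_compl_sym. rewrite Hp. apply join_le;
        [apply le_joinl | apply le_joinr]; apply meet_lel, le_refl.
    + rewrite Hq. apply join_le;
        [apply le_joinl | apply le_joinr]; apply meet_lel, le_refl.
    + apply (le_trans c).
      * apply join_le; apply meet_ler, le_refl.
      * apply le_compl_sym. apply join_le; apply meet_ler, le_refl.
  - assert (Hs : le s c) by (apply join_le; apply meet_ler, le_refl).
    assert (Ht : le t (compl c)) by (apply join_le; apply meet_ler, le_refl).
    apply le_wle, join_le; apply le_meet.
    + apply le_joinl, le_meet; [apply meet_lel, meet_lel, le_refl | now apply meet_ler].
    + apply le_joinl, le_meet; [apply meet_lel, meet_ler, le_refl | now apply meet_ler].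
    + apply le_joinr, le_meet; [apply meet_lel, meet_lel, le_refl | now apply meet_ler].
    + apply le_joinr, le_meet; [apply meet_lel, meet_ler, le_refl | now apply meet_ler].
Qed.

(** By De Morgan, with [u], [x], [y] the three equivalences, the left side is the complement of
    [(u ∩ (x ∪ y)) ∩ (x ∩ y)']. *)
Lemma imp0_equiv_trans a b c :
  imp0 (equiv a b) (equiv (equiv a c) (equiv b c)) = one.
Proof.
  pose proof (wle_skew _ _ (meet_equiv_wle a b c)) as H. unfold imp0.
  set (u := equiv a b) in *. set (x := equiv a c) in *. set (y := equiv b c) in *.
  unfold equiv.
  rewrite <- (compl_join x y), (joinC L (meet x y)), joinA, <- compl_meet.
  rewrite <- (complK L (meet x y)), <- compl_meet, H. apply compl_zero.
Qed.

End Ortholattice.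

(** * The counterexample for part (ii) *)

Inductive axis := ax1 | ax2 | ax3.

Definition same_axis (i j : axis) : bool :=
  match i, j with
  | ax1, ax1 | ax2, ax2 | ax3, ax3 => true
  | _, _ => false
  end.

(* Meaningful only for distinct arguments. *)
Definition third_axis (i j : axis) : axis :=
  match i, j with
  | ax1, ax2 | ax2, ax1 => ax3
  | ax1, ax3 | ax3, ax1 => ax2
  | _, _ => ax1
  end.

(* [line h i] and [plane h i] are the two copies, the larger one for [h = true], of the
   [i]-th atom and of its Boolean complement. *)
Inductive split_cube :=
| bot
| top
| line (h : bool) (i : axis)
| plane (h : bool) (i : axis).

(** Reversing the order swaps the copies. Hence the larger copy of an atom meets the complement of
    the smaller in [bot], which breaks orthomodularity. *)
Definition cube_compl (x : split_cube) : split_cube :=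
  match x with
  | bot => top
  | top => bot
  | line h i => plane (negb h) i
  | plane h i => line (negb h) i
  end.

Definition cube_meet (x y : split_cube) : split_cube :=
  match x, y with
  | bot, _ | _, bot => bot
  | top, z | z, top => z
  | line h i, line k j => if same_axis i j then line (andb h k) i else bot
  | line h i, plane k j | plane k j, line h i =>
      if same_axis i j then bot else line (andb h k) i
  | plane h i, plane k j =>
      if same_axis i j then plane (andb h k) i else line (andb h k) (third_axis i j)
  end.

Definition cube_join (x y : split_cube) : split_cube :=
  cube_compl (cube_meet (cube_compl x) (cube_compl y)).

Ltac split_cube_cases :=
  repeat match goal with
  | |- forall _ : split_cube, _ => intros [| | [|] [| |] | [|] [| |]]
  end.

Definition split_cube_OL : ortholattice.
Proof.
  refine (OL split_cube cube_meet cube_join cube_compl bot top _ _ _ _ _ _ _ _ _ _ _ _);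
    abstract (split_cube_cases; try reflexivity; discriminate).
Defined.

(** Identifying the copies is a homomorphism onto a Boolean algebra, where the law holds, and only
    [top] is sent to [1]. *)
Lemma split_cube_WOML : is_WOML split_cube_OL.
Proof. unfold is_WOML. simpl. split_cube_cases; reflexivity. Qed.

Theorem theorem5 :
  (forall (L : ortholattice), is_WOML L ->
     forall a b c : L,
       imp0 (equiv a b) (equiv (equiv a c) (equiv b c)) = one)
  /\
  (exists (L : ortholattice), is_WOML L /\
     exists a b c : L,
       meet (equiv a b) (join (equiv b c) (equiv a c))
       <> join (meet (equiv a b) (equiv b c)) (meet (equiv a b) (equiv a c))).
Proof.
  split.
  - intros L HL. now apply imp0_equiv_trans.
  - exists split_cube_OL. split; [exact split_cube_WOML |].
    (* The join on the left is [top], so that side is [line true ax3]; both meets on the right are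
       [line false ax3]. *)
    exists bot, (plane false ax3), (line true ax2). discriminate.
Qed.
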